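(* Let $X$ be a regular curve and let $f:X\to X$ be a homeomorphism without periodic points. Then $f$ possesses a unique minimal set.
   Context: A continuum is a nonempty connected compact metric space. A continuum $X$ is a regular curve if for each $x\in X$ and each open neighborhood $V$ of $x$ in $X$ there is an open neighborhood $U$ of $x$ in $X$ with $U\subset V$ and with finite boundary $\partial U$. A point $x\in X$ is periodic for $f$ if $f^n(x)=x$ for some positive integer $n$. A subset $M\subset X$ is minimal for $f$ if it is nonempty, closed and strongly invariant ($f(M)=M$), and no proper subset of $M$ has these three properties. *)

(* Defs.v *)
From mathcomp Require Import all_boot all_order all_algebra.
From mathcomp Require Import all_classical all_reals all_analysis.

Set Implicit Arguments.
Unset Strict Implicit.
Unset Printing Implicit Defensive.

Local Open Scope classical_set_scope.

Definition continuum (R : realType) (X : metricType R) : Prop :=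
  [/\ [set: X] !=set0, connected [set: X] & compact [set: X]].

Definition boundary (X : topologicalType) (U : set X) : set X :=
  closure U `\` interior U.

Definition regular_curve (R : realType) (X : metricType R) : Prop :=
  continuum X /\
  forall (x : X) (V : set X), open_nbhs x V ->
    exists U : set X, [/\ open_nbhs x U, U `<=` V & finite_set (boundary U)].

Definition homeomorphism (X Y : topologicalType) (f : X -> Y) : Prop :=
  continuous f /\
  exists g : Y -> X, [/\ cancel f g, cancel g f & continuous g].

Definition periodic_point (X : Type) (f : X -> X) (x : X) : Prop :=
  exists2 n : nat, (0 < n)%N & iter n f x = x.

Definition nonempty_closed_invariant (X : topologicalType) (f : X -> X)
    (M : set X) : Prop :=
  [/\ M !=set0, closed M & f @` M = M].

Definition minimal_set (X : topologicalType) (f : X -> X) (M : set X) : Prop :=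
  nonempty_closed_invariant f M /\
  forall N : set X, N `<` M -> ~ nonempty_closed_invariant f N.

(* Main.v *)
(* Two disjoint nonempty closed invariant sets M and N can be separated by a
   finite set. Among the closed sets containing M and missing N, those whose
   boundary has the least cardinality k form a class stable under finite
   intersections, as for minimal cuts: |bd (A & B)| + |bd (A | B)| is at most
   |bd A| + |bd B|. The class is also stable under f and its inverse.
   Intersecting all f^i(A), i in Z, gives an invariant closed set C as a
   decreasing limit of sets of the class; by regularity of X every boundary
   point of C is a limit of boundary points of these sets, so bd C is finite.
   By connectedness bd C is nonempty, and it is invariant, hence made of
   periodic points. *)

From mathcomp Require Import finmap.
Require Import Defs.
From mathcomp Require Import all_boot all_order all_algebra.
From mathcomp Require Import all_classical all_reals all_analysis.

Set Implicit Arguments.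
Unset Strict Implicit.
Unset Printing Implicit Defensive.

Local Open Scope classical_set_scope.

(** * Boundaries of unions, intersections and preimages *)

Lemma boundaryI_sub (T : topologicalType) (A B : set T) :
  boundary (A `&` B) `<=` boundary A `|` boundary B.
Proof.
move=> x [/closureI[cA cB]]; rewrite interiorI => nAB.
have [iA|nA] := pselect (A° x); last by left.
by right; split => // iB; apply: nAB.
Qed.

Lemma boundaryU_sub (T : topologicalType) (A B : set T) :
  boundary (A `|` B) `<=` boundary A `|` boundary B.
Proof.
move=> x []; rewrite closureU => -[cA|cB] nAB; [left|right]; split => // i;
  apply: nAB; apply: interiorU; [by left|by right].
Qed.

Lemma boundaryIU_sub (T : topologicalType) (A B : set T) :
  boundary (A `&` B) `&` boundary (A `|` B) `<=` boundary A `&` boundary B.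
Proof.
move=> x [[/closureI[cA cB] _] [_ nU]]; split; split => // i;
  apply: nU; apply: interiorU; [by left|by right].
Qed.

Lemma boundary_closure_sub (T : topologicalType) (A : set T) :
  boundary (closure A) `<=` boundary A.
Proof.
move=> x [cA niA]; split.
  by move: cA; rewrite -(proj1 (closure_id _)) //; exact: closed_closure.
by move=> iA; apply: niA; apply: interiorS iA; exact: subset_closure.
Qed.

Lemma boundary_preimage_sub (S T : topologicalType) (f : S -> T) (A : set T) :
  continuous f -> boundary (f @^-1` A) `<=` f @^-1` boundary A.
Proof.
move=> fc x [cA niA]; split.
  have /continuous_closedP/(_ (closure A) (@closed_closure _ A)) := fc.
  move=> /closure_id cl; suff : (f @^-1` closure A) x by [].
  rewrite cl; apply: closureS cA => y.
  exact: (@subset_closure _ A (f y)).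
by move=> iA; apply: niA; exact: fc iA.
Qed.

(** A closed set with empty boundary coincides with its interior, hence is clopen. *)
Lemma boundary_nonempty (T : topologicalType) (A : set T) :
  connected [set: T] -> closed A -> A !=set0 -> A != [set: T] ->
  boundary A !=set0.
Proof.
move=> cT clA A0 /eqP AT; apply: contrapT => /nonemptyPn b0.
apply: AT; apply: cT => //; exists A; rewrite ?setTI//.
apply/interior_id; apply/seteqP; split; first exact: interior_subset.
move=> x Ax; apply: contrapT => niA.
by have : boundary A x; [split=> //; exact: subset_closure|rewrite b0].
Qed.

Lemma interior_off_boundary (T : topologicalType) (A : set T) (x : T) :
  A x -> ~ boundary A x -> A° x.
Proof.
move=> Ax nb; apply: contrapT => niA; apply: nb; split => //.
exact: subset_closure.
Qed.

(** The boundaries of [A & B] and [A | B] have their union inside the union of [boundary A] and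
    [boundary B], and their intersection inside the intersection of these. Counting both pairs by
    inclusion-exclusion gives the submodular inequality. *)
Lemma card_boundaryIU (T : topologicalType) (A B : set T) :
  finite_set (boundary A) -> finite_set (boundary B) ->
  #|` fset_set (boundary (A `&` B))| + #|` fset_set (boundary (A `|` B))| <=
  #|` fset_set (boundary A)| + #|` fset_set (boundary B)|.
Proof.
move=> fA fB.
have fU : finite_set (boundary A `|` boundary B) by rewrite finite_setU.
have f1 := sub_finite_set (@boundaryI_sub _ A B) fU.
have f2 := sub_finite_set (@boundaryU_sub _ A B) fU.
rewrite -cardfsUI -[leqRHS]cardfsUI -!fset_setU// -!fset_setI//.
apply: leq_add; apply: fsubset_leq_card; rewrite -fset_set_sub.
- by move=> x [/boundaryI_sub|/boundaryU_sub].
- by rewrite finite_setU.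
- exact: fU.
- exact: boundaryIU_sub.
- exact: finite_setIl.
- exact: finite_setIl.
Qed.

(** * Boundary of a decreasing intersection *)

Lemma disjoint_nbhs_fset (T : topologicalType) (S : {fset T}) :
  hausdorff_space T ->
  exists V : T -> set T, (forall p, nbhs p (V p)) /\
    forall p q, p \in S -> q \in S -> V p `&` V q !=set0 -> p = q.
Proof.
move=> hT.
have /choice[W HW] : forall pq : T * T, exists AB : set T * set T,
    pq.1 != pq.2 ->
    [/\ nbhs pq.1 AB.1, nbhs pq.2 AB.2 & AB.1 `&` AB.2 = set0].
  move=> [p q] /=; have [->|pq] := eqVneq p q; first by exists (setT, setT).
  move: hT; rewrite open_hausdorff => /(_ _ _ pq).
  move=> [[A B] /= [pA qB] [oA oB /eqP AB]].
  exists (A, B) => _ /=; split => //; apply: open_nbhs_nbhs; split => //.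
    by move: pA; rewrite inE.
  by move: qB; rewrite inE.
(* The choice [W] depends on the order of the pair, so [V p] takes the first half of [W (p, q)] and
   the second half of [W (q, p)]; then [V p] and [V q] lie in the two disjoint halves of
   [W (p, q)]. *)
pose V p := \bigcap_(q in [set` S])
  (if q == p then setT else (W (p, q)).1 `&` (W (q, p)).2).
exists V; split=> [p|p q pS qS [x [xp xq]]].
  apply: filter_bigI => q _; case: ifPn => [_|qp]; first exact: filterT.
  have pq : p != q by rewrite eq_sym.
  have [+ _ _] := HW (p, q) pq.
  by have [_ + _] := HW (q, p) qp; move=> *; apply: filterI.
apply/eqP; apply: contrapT => /negP pq.
have [_ _] := HW (p, q) pq; move/seteqP => [+ _] => /(_ x); apply; split.
  by have := xp q qS; rewrite eq_sym (negPf pq) => -[].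
by have := xq p pS; rewrite (negPf pq) => -[].
Qed.

Section BoundaryOfIntersection.
Variables (R : realType) (X : metricType R).
Hypothesis hX : regular_curve X.

Lemma regular_curve_closure_nbhs (x : X) (V : set X) : nbhs x V ->
  exists U, [/\ open_nbhs x U, closure U `<=` V & finite_set (boundary U)].
Proof.
move=> /uniform_regular[W xW WV].
have [|U [xU UW fU]] := hX.2 x (W°).
  by split; [exact: open_interior|].
exists U; split => //; apply: subset_trans WV; apply: closureS.
exact: subset_trans UW (@interior_subset _ _).
Qed.

Variable A : nat -> set X.
Hypothesis clA : forall n, closed (A n).
Hypothesis decA : forall m n, m <= n -> A n `<=` A m.

(* If [boundary (A n)] missed a small neighbourhood [U] of [x] for infinitely
   many [n], the differences [A m `\` A n] would be relatively clopen there; as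
   soon as the traces of [A m] and [A n] on the finite set [boundary U] agree,
   connectedness makes the difference empty in [U], so that [A n] is stationary
   near [x]. *)
Lemma boundary_bigcap_approx (x : X) (V : set X) :
  boundary (\bigcap_n A n) x -> nbhs x V ->
  exists N, forall n, N <= n -> boundary (A n) `&` V !=set0.
Proof.
move=> [clx nix] xV; apply: contrapT => /forallNP noN; apply: nix.
pose C := \bigcap_n A n.
have Cx n : A n x.
  suff : C x by apply.
  by move: clx; rewrite -(proj1 (closure_id _)) //; exact: closed_bigI.
have often N : exists2 n, N <= n & forall y, V y -> ~ boundary (A n) y.
  have /existsNP[n /not_implyP[Nn /nonemptyPn b0]] := noN N.
  by exists n => // y Vy bny; have : (boundary (A n) `&` V) y by []; rewrite b0.
have [U [[oU Ux] UV fU]] := regular_curve_closure_nbhs xV.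
have [N HN] : exists N, forall y, boundary U y -> A N y -> C y.
  have /choice[h Hh] : forall y, exists n, A n y -> C y.
    move=> y; have [Cy|/existsNP[n /not_implyP[_ nAy]]] := pselect (C y).
      by exists 0.
    by exists n.
  exists (\max_(y <- fset_set (boundary U)) h y) => y bUy AN.
  apply: Hh; apply: decA AN; apply: leq_bigmax_seq => //.
  by rewrite in_fset_set// inE.
have [m Nm bm] := often N.
have UC : A m `&` U `<=` C.
  move=> y0 [Am0 U0] n _; apply: contrapT => nA0.
  have [n' + bn] := often (maxn m n); rewrite geq_max => /andP[mn' nn'].
  pose E := (A m `\` A n') `&` U.
  suff EX : E = setT by have [[_]] : E x by rewrite EX.
  (* This is what makes [E] closed: a point of [closure U] outside [U] lies in [boundary U], where
     belonging to [A m], hence to [A N], already forces belonging to [A n']. *)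
  have EE y : A m y -> ~ A n' y -> closure U y -> E y.
    move=> Ay nAy cUy; split => //; apply: contrapT => nUy.
    apply: nAy; apply: (HN y) => //; last exact: decA Nm _ Ay.
    by split => // /interior_subset.
  case: hX => [[_ cX _] _]; apply: cX.
  - exists y0; split => //; split => // /(decA nn') //.
  - exists E; rewrite ?setTI//.
    suff -> : E = (A m)° `&` ~` A n' `&` U.
      by do 2?apply: openI; rewrite ?openC//; exact: open_interior.
    apply/seteqP; split => y [[a b] c]; split => //; split => //.
      apply: interior_off_boundary => //; apply: bm; apply: UV.
      exact: subset_closure.
    exact: interior_subset.
  - exists E; rewrite ?setTI//.
    move=> y clE.
    have Ay : A m y by apply: clA; apply: closureS clE => z [[]].
    have Uy : closure U y by apply: closureS clE => z [].
    apply: EE => // A'y.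
    have /clE[z [[[_ +] _] iz]] : nbhs y (A n').
      by apply: interior_off_boundary => //; apply: bn; exact: UV.
    by apply.
apply: (@interiorS _ (A m `&` U)) => //.
rewrite interiorI; split; last by move/interior_id: oU => ->.
apply: interior_off_boundary => //; apply: bm; apply: UV.
exact: subset_closure.
Qed.

(** Any [k.+1] boundary points of the intersection would have disjoint neighbourhoods, all of which
    meet [boundary (A n)] for one large [n]; this boundary would then have more than [k] points. *)
Lemma boundary_bigcap_finite (k : nat) :
  (forall n, finite_set (boundary (A n))) ->
  (forall n, #|` fset_set (boundary (A n))| <= k) ->
  finite_set (boundary (\bigcap_n A n)).
Proof.
move=> fA leA; apply: contrapT => /(infinite_set_fset k.+1)[S SC].
apply/negP; rewrite -leqNgt.
have [V [nV dV]] := disjoint_nbhs_fset S (@metric_hausdorff _ X).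
have /choice[N HN] : forall p, exists N, p \in S ->
    forall n, N <= n -> boundary (A n) `&` V p !=set0.
  move=> p; have [pS|_] := boolP (p \in S); last by exists 0.
  by have [N HN] := boundary_bigcap_approx (SC p pS) (nV p); exists N.
pose n := \max_(p <- S) N p.
have /choice[h Hh] : forall p, exists y, p \in S -> (boundary (A n) `&` V p) y.
  move=> p; have [pS|_] := boolP (p \in S); last by exists p.
  have [|y Hy] := HN p pS n; last by exists y.
  exact: leq_bigmax_seq.
apply: leq_trans (leA n).
have <- : #|` [fset h p | p in S]%fset| = #|` S|.
  rewrite card_in_imfset// => p q pS qS hpq; apply: (dV p q) => //.
  by exists (h p); split; [case: (Hh p pS)|rewrite hpq; case: (Hh q qS)].
apply: fsubset_leq_card; apply/fsubsetP => y /imfsetP[p /= pS ->].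
by rewrite in_fset_set// inE; case: (Hh p pS).
Qed.

End BoundaryOfIntersection.

(** * Closed sets with finite boundary separating two sets *)

Definition separator (T : topologicalType) (M N A : set T) :=
  [/\ closed A, M `<=` A, A `<=` ~` N & finite_set (boundary A)].

Lemma separator_setI (T : topologicalType) (M N A B : set T) :
  separator M N A -> separator M N B -> separator M N (A `&` B).
Proof.
move=> [cA MA AN fA] [cB MB BN fB]; split.
- exact: closedI.
- by move=> x Mx; split; [exact: MA|exact: MB].
- by move=> x [/AN].
- by apply: sub_finite_set (@boundaryI_sub _ A B) _; rewrite finite_setU.
Qed.

Lemma separator_setU (T : topologicalType) (M N A B : set T) :
  separator M N A -> separator M N B -> separator M N (A `|` B).
Proof.
move=> [cA MA AN fA] [cB MB BN fB]; split.
- exact: closedU.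
- by move=> x Mx; left; exact: MA.
- by move=> x [/AN|/BN].
- by apply: sub_finite_set (@boundaryU_sub _ A B) _; rewrite finite_setU.
Qed.

(** Compactness, in filter form: if no finite union of closed sets with finite boundary missing [N]
    covered [M], the remainders of [M] would have a cluster point. It lies in [M], hence off [N],
    and the closure of a small regular neighbourhood of it is one of the removed sets. *)
Lemma separator_exists (R : realType) (X : metricType R) (M N : set X) :
  regular_curve X -> closed M -> closed N -> M `&` N = set0 ->
  exists A, separator M N A.
Proof.
move=> hX cM cN MN; apply: contrapT => nosep.
pose D := [set A : set X |
  [/\ closed A, A `<=` ~` N & finite_set (boundary A)]].
pose F := filter_from D (fun A => M `\` A).
have FF : ProperFilter F.
  apply: filter_from_proper; first apply: filter_from_filter.
  - exists set0; split=> //; first exact: closed0.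
    by rewrite /boundary closure0 set0D.
  - move=> A B [cA AN fA] [cB BN fB]; exists (A `|` B).
      split; [exact: closedU|by move=> x [/AN|/BN]|].
      by apply: sub_finite_set (@boundaryU_sub _ A B) _; rewrite finite_setU.
    by move=> x [Mx nAB]; split; split => // ?; apply: nAB; [left|right].
  - move=> A [cA AN fA]; apply: contrapT => /nonemptyPn MA; apply: nosep.
    by exists A; split => //; rewrite -setD_eq0.
have [x [_ clx]] : [set: X] `&` cluster F !=set0.
  by case: hX => [[_ _ cX] _]; apply: cX; exact: filterT.
have Mx : M x.
  apply: cM => V /(clx M V); apply.
  exists set0; last by move=> ? [].
  split=> //; first exact: closed0.
  by rewrite /boundary closure0 set0D.
have xN : nbhs x (~` N).
  apply: open_nbhs_nbhs; split; first exact: closed_openC.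
  by move=> Nx; have : (M `&` N) x by []; rewrite MN.
have [U [[oU Ux] UN fU]] := regular_curve_closure_nbhs hX xN.
have [] := clx (M `\` closure U) U.
- exists (closure U) => //; split=> //; first exact: closed_closure.
  exact: sub_finite_set (@boundary_closure_sub _ _) fU.
- by apply: open_nbhs_nbhs.
- by move=> y [[_ nU] /subset_closure].
Qed.

(** * Invariance and periodic points *)

Lemma iter_inj (T : Type) (f : T -> T) (n : nat) :
  injective f -> injective (iter n f).
Proof. by move=> fI; elim: n => // n IHn x y /= /fI/IHn. Qed.

(** An orbit inside a finite set repeats a value, and injectivity cancels the common initial
    iterates. *)
Lemma finite_forward_invariant_periodic (T : Type) (f : T -> T) (B : set T) :
  injective f -> finite_set B -> B !=set0 -> (forall x, B x -> B (f x)) ->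
  exists x, periodic_point f x.
Proof.
move=> fI fB [x Bx] Bf.
have Bi n : B (iter n f x) by elim: n => // n /Bf.
apply: contrapT => nper.
have inj : injective (fun n => iter n f x).
  suff H m n : m < n -> iter m f x = iter n f x -> False.
    move=> m n eq; case: (ltngtP m n) => // lt.
      by case: (H _ _ lt eq).
    by case: (H _ _ lt (esym eq)).
  move=> mn; rewrite -(subnKC (ltnW mn)) iterD => /(iter_inj fI) eq.
  by apply: nper; exists x, (n - m) => //; rewrite subn_gt0.
apply: infinite_nat.
apply: (@sub_finite_set _ _ ((fun n => iter n f x) @^-1` B)).
  by move=> n _; exact: Bi.
by apply: finite_preimage => // m n _ _ /inj.
Qed.

(** The map [f] sends the boundary of the preimage injectively into [boundary A], so the number of
    boundary points does not grow. *)
Lemma separator_preimage (T : topologicalType) (f : T -> T) (M N A : set T) :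
  continuous f -> injective f -> M `<=` f @^-1` M -> N `<=` f @^-1` N ->
  separator M N A ->
  separator M N (f @^-1` A) /\
  #|` fset_set (boundary (f @^-1` A))| <= #|` fset_set (boundary A)|.
Proof.
move=> fc fI MM NN [cA MA AN fA].
have bfA := @boundary_preimage_sub _ _ f A fc.
have ffA : finite_set (boundary (f @^-1` A)).
  apply: sub_finite_set bfA _.
  by apply: finite_preimage => // x y _ _ /fI.
split; first split => //.
- by move/continuous_closedP: fc; apply.
- by move=> x /MM /MA.
- by move=> x /AN + /NN.
have <- : #|` [fset f p | p in fset_set (boundary (f @^-1` A))]%fset| =
    #|` fset_set (boundary (f @^-1` A))|.
  by rewrite card_imfset.
apply: fsubset_leq_card; apply/fsubsetP => y /imfsetP[p /= + ->].
by rewrite !in_fset_set// !inE => /bfA.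
Qed.

Lemma closed_invariant_meet (R : realType) (X : metricType R) (f g : X -> X)
    (M N : set X) :
  regular_curve X -> cancel f g -> cancel g f -> continuous f ->
  continuous g -> (forall x, ~ periodic_point f x) ->
  nonempty_closed_invariant f M -> nonempty_closed_invariant f N ->
  M `&` N !=set0.
Proof.
move=> hX fK gK fc gc nper [M0 cM fM] [N0 cN fN].
apply: contrapT => /nonemptyPn MN.
have stable (B : set X) : f @` B = B -> B `<=` f @^-1` B /\ B `<=` g @^-1` B.
  move=> fB; split=> x; first by move=> Bx; rewrite -fB; exists x.
  by rewrite -{1}fB => -[y By <-]; rewrite /= fK.
have [Mf Mg] := stable M fM; have [Nf Ng] := stable N fN.
pose P k := `[< exists A, separator M N A /\
  #|` fset_set (boundary A)| = k >].
have exP : exists k, P k.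
  have [A sA] := separator_exists hX cM cN MN.
  by exists #|` fset_set (boundary A)|; apply/asboolP; exists A.
case: (ex_minnP exP) => k /asboolP[A0 [sA0 kA0]] kmin.
have kle A : separator M N A -> k <= #|` fset_set (boundary A)|.
  by move=> sA; apply: kmin; apply/asboolP; exists A.
pose S A := separator M N A /\ #|` fset_set (boundary A)| <= k.
have SI A B : S A -> S B -> S (A `&` B).
  move=> [sA kA] [sB kB]; split; first exact: separator_setI.
  have [[_ _ _ fA] [_ _ _ fB]] := (sA, sB).
  (* The union is a separator too, so its boundary uses at least [k] of the at most [k + k] points,
     leaving at most [k] for the intersection. *)
  rewrite -(leq_add2r k); apply: leq_trans (leq_add kA kB).
  apply: leq_trans (card_boundaryIU fA fB).
  by rewrite leq_add2l; apply: kle; exact: separator_setU.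
have Sf A : S A -> S (f @^-1` A).
  move=> [sA kA].
  have [] := separator_preimage fc (can_inj fK) Mf Nf sA.
  by move=> ? /leq_trans; split=> //; auto.
have Sg A : S A -> S (g @^-1` A).
  move=> [sA kA].
  have [] := separator_preimage gc (can_inj gK) Mg Ng sA.
  by move=> ? /leq_trans; split=> //; auto.
(* As [f] and [g] are mutually inverse, [A n] is the intersection of the images of [A0] under the
   iterates of [f] of exponent between [-n] and [n]. Each stage is a finite intersection, so it
   stays in [S]. *)
pose A := fix A n := if n is n'.+1
  then A n' `&` (f @^-1` A n' `&` g @^-1` A n') else A0.
have SA n : S (A n).
  elim: n => [|n IHn]; first by split => //; rewrite kA0.
  by apply: (SI) => /=; [|apply: (SI)]; auto.
have sA n : separator M N (A n) by case: (SA n).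
have decA m n : m <= n -> A n `<=` A m.
  elim: n => [|n IHn]; first by rewrite leqn0 => /eqP ->.
  by rewrite leq_eqVlt => /predU1P[-> //|/IHn mn] x [/mn].
pose C := \bigcap_n A n.
have clA n : closed (A n) by case: (sA n).
have fC : C = f @^-1` C.
  apply/seteqP; split => x Cx n _; first by have [_ []] := Cx n.+1 I.
  by have [_ [_]] := Cx n.+1 I; rewrite /= fK.
(* Being closed, containing [M] and missing [N] pass directly to the infinite intersection;
   finiteness of the boundary needs the uniform bound [k]. *)
have clC : closed C by exact: closed_bigI.
have MC : M `<=` C by move=> x Mx n _; case: (sA n) => _ + _ _; exact.
have CT : C != setT.
  apply/eqP => CT; case: N0 => x Nx; have : C x by rewrite CT.
  by move=> /(_ 0 I); case: sA0 => _ _ + _ => /[apply].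
have bC0 : boundary C !=set0.
  apply: boundary_nonempty => //; first by case: hX => [[]].
  by case: M0 => x /MC; exists x.
have bCf : finite_set (boundary C).
  apply: (boundary_bigcap_finite hX clA decA (k := k)) => n.
    by case: (sA n).
  by case: (SA n).
have [|x /nper//] := finite_forward_invariant_periodic (can_inj fK) bCf bC0.
by move=> x; rewrite {1}fC => /(boundary_preimage_sub fc).
Qed.

(** * Existence and uniqueness of minimal sets *)

Lemma minimal_set_exists (T : topologicalType) (f : T -> T) :
  bijective f -> compact [set: T] -> [set: T] !=set0 ->
  exists M, minimal_set f M.
Proof.
move=> [g fK gK] cT T0.
(* [Zorn_bigcup] produces sets maximal for inclusion, so invariant closed sets are handled through
   their complements. *)
pose P (U : set T) := nonempty_closed_invariant f (~` U).
have P0 : P set0.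
  rewrite /P setC0; split => //.
  by apply/seteqP; split => // y _; exists (g y).
have [|U [PU maxU]] := @Zorn_bigcup T P.
  (* Adjoining [set0] leaves the union unchanged and accounts for the empty chain: the complements
     then form a nonempty filter base, and a cluster point of it lies in all of them. *)
  move=> F FP Ftot; pose D := F `|` [set set0].
  have DP U : D U -> P U by move=> [/FP//|->].
  have -> : \bigcup_(U in F) U = \bigcup_(U in D) U.
    apply/seteqP; split => x [U DU Ux]; first by exists U => //; left.
    by case: DU Ux => [FU Ux|-> //]; exists U.
  split.
  - have FF : ProperFilter (filter_from D setC).
      apply: filter_from_proper; first apply: filter_from_filter.
      + by exists set0; right.
      + move=> U V [FU|->] [FV|->].
        * have [UV|VU] := Ftot _ _ FU FV.
            by exists V; [left|move=> x nV; split => // /UV].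
          by exists U; [left|move=> x nU; split => // /VU].
        * by exists U; [left|rewrite setC0 setIT].
        * by exists V; [left|rewrite setC0 setTI].
        * by exists set0; [right|rewrite setC0 setTI].
      + by move=> U /DP[].
    have [|x [_ clx]] := cT _ FF; first exact: filterT.
    exists x => -[U DU]; have [_ cU _] := DP U DU.
    suff : (~` U) x by [].
    by apply: cU => V /(clx (~` U) V); apply; exists U.
  - by rewrite setC_bigcup; apply: closed_bigI => U /DP[].
  - rewrite setC_bigcup; apply/seteqP; split => [_ [x Dx <-] U DU|y Dy].
      by have [_ _ <-] := DP U DU; exists x => //; exact: Dx.
    exists (g y); last exact: gK.
    move=> U DU; have [_ _ eU] := DP U DU.
    by have := Dy U DU; rewrite -{1}eU => -[x Ux <-]; rewrite fK.
exists (~` U); split => // N [NU nUN] inN; apply: (maxU (~` N)).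
  split=> [x Ux /NU //|NU']; apply: nUN => x nUx.
  by apply: contrapT => /NU'.
by rewrite /P setCK.
Qed.

Theorem theorem4p1 (R : realType) (X : metricType R) (f : X -> X)
    (hX : regular_curve X) (hf : homeomorphism f)
    (hper : forall x : X, ~ periodic_point f x) :
  exists! M : set X, minimal_set f M.
Proof.
case: hf => fc [g [fK gK gc]]; have [[T0 _ cT] _] := hX.
have [|M minM] := minimal_set_exists _ cT T0 (f := f); first by exists g.
exists M; split => // N minN.
have [[iM MP] [iN NP]] := (minM, minN).
have MN0 := closed_invariant_meet hX fK gK fc gc hper iM iN.
(* Injectivity of [f] makes the preimages of a common point in [M] and in [N] coincide, so the
   intersection is invariant; by minimality it equals both sets. *)
have iMN : nonempty_closed_invariant f (M `&` N).
  case: iM iN => [_ cM fM] [_ cN fN]; split => //; first exact: closedI.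
  apply/seteqP; split => [_ [x [Mx Nx] <-]|].
    by split; [rewrite -fM|rewrite -fN]; exists x.
  move=> y []; rewrite -{1}fM -{1}fN => -[x Mx <-] [z Nz /(can_inj fK) zx].
  by exists x => //; split => //; rewrite -zx.
have MN : M `<=` N.
  apply: contrapT => nMN; apply: (MP (M `&` N)) => //.
  split; first by move=> x [].
  by move=> MMN; apply: nMN => x /MMN[].
have NM : N `<=` M.
  apply: contrapT => nNM; apply: (NP (M `&` N)) => //.
  split; first by move=> x [].
  by move=> NMN; apply: nNM => x /NMN[].
exact/seteqP.
Qed.
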